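(* Let $d\ge2$ and $n\geq 7$ be integers and let $U\in \mathrm{U}(\mathcal{H}_{d})$ be a unitary operator with $\det(U)=e^{\mathrm{i}\theta}\neq1$ for some $\theta\in (-\pi,\pi]\setminus\{0\}$. Then, with the aid of one ancilla qudit initialized in and restored to the state $|0\rangle_{\mathrm{anc}}$, the gate $\mathrm{C}^{n}_{(1,\dots,n-1),n}(U)$ can be synthesized using at most $2N_{\mathrm{SU}}(d,n)$ CINC gates; that is, there is a product $W$ of CINC gates and single-qudit gates on $n+1$ qudits, containing at most $2N_{\mathrm{SU}}(d,n)$ CINC gates, such that $W(|\psi\rangle\otimes|0\rangle_{\mathrm{anc}})=\big(\mathrm{C}^{n}_{(1,\dots,n-1),n}(U)|\psi\rangle\big)\otimes|0\rangle_{\mathrm{anc}}$ for every $|\psi\rangle\in\mathcal{H}_d^{\otimes n}$. Here $$N_{\mathrm{SU}}(d,n)=\begin{cases}16n-48, & \text{if } d=2,\\ 32n-160, & \text{if } d=3,\\ (32d-40)n-192d+272, & \text{if } d\geq 4.\end{cases}$$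
   Context: $\mathcal{H}_{d}$ is a $d$-dimensional complex Hilbert space with orthonormal (computational) basis $|0\rangle,\dots,|d-1\rangle$ (a qudit); $\mathrm{U}(\mathcal{H})$ is the group of unitary operators on $\mathcal{H}$. $X_d=|0\rangle\langle d-1|+\sum_{a=0}^{d-2}|a+1\rangle\langle a|$. For distinct indices $i_1,\dots,i_r,j\in\{1,\dots,N\}$ and $U\in\mathrm{U}(\mathcal{H}_d)$, the gate $\mathrm{C}^{N}_{(i_1,\dots,i_r),j}(U)\in\mathrm{U}(\mathcal{H}_d^{\otimes N})$ acts on a computational basis vector $|x_1\dots x_N\rangle$ by applying $U$ to the $j$-th tensor factor if $x_{i_1}=\dots=x_{i_r}=d-1$, and as the identity otherwise. A CINC gate on $N$ qudits is any $\mathrm{C}^{N}_{i,j}(X_d)$ with $i\neq j$. A single-qudit gate is an arbitrary unitary acting nontrivially on one tensor factor only (their number is not restricted). *)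

(* Defs.v *)
From HB Require Import structures.
From mathcomp Require Import all_boot all_order all_algebra.
From mathcomp.algebra Require Import spectral.
From mathcomp.real_closed Require Import complex.
From mathcomp Require Import reals trigo.
Set Implicit Arguments.
Unset Strict Implicit.
Unset Printing Implicit Defensive.
Import Order.TTheory GRing.Theory Num.Theory.
Local Open Scope ring_scope.
Local Open Scope complex_scope.

(* The complex field is R[i] for a realType R.  The N-fold
   tensor power of H_d is realised as the space of column vectors indexed,
   through enum_rank, by the d^N computational basis labels x_1 ... x_N. *)
Definition cfg (d N : nat) := {ffun 'I_N -> 'I_d}.

Definition qstate (R : realType) (d N : nat) := 'cV[R[i]]_#|cfg d N|.

Definition qop (R : realType) (d N : nat) := 'M[R[i]]_#|cfg d N|.

Definition expi (R : realType) (t : R) : R[i] := cos t +i* sin t.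

Definition ket (R : realType) (d N : nat) (x : cfg d N) : qstate R d N :=
  delta_mx (enum_rank x) 0.

Definition upd (d N : nat) (x : cfg d N) (j : 'I_N) (a : 'I_d) : cfg d N :=
  [ffun i => if i == j then a else x i].

(* U |b> = \sum_a U a b |a> *)
Definition apply_at (R : realType) (d N : nat) (U : 'M[R[i]]_d) (j : 'I_N)
    (x : cfg d N) : qstate R d N :=
  \sum_(a < d) U a (x j) *: ket R (upd x j a).

(* C^N_{S,j}(U), meaningful for j \notin S: column x is the image of |x>. *)
Definition cgate (R : realType) (d N : nat) (S : {set 'I_N}) (j : 'I_N)
    (U : 'M[R[i]]_d) : qop R d N :=
  \matrix_(k, l)
    (let x := enum_val l : cfg d N in
     if [forall i in S, x i == d.-1 :> nat] then apply_at U j x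
     else ket R x) k 0.

Definition single (R : realType) (d N : nat) (j : 'I_N) (V : 'M[R[i]]_d) :
    qop R d N :=
  \matrix_(k, l) apply_at V j (enum_val l) k 0.

(* ordS is the cyclic successor on 'I_d *)
Definition Xgate (R : realType) (d : nat) : 'M[R[i]]_d :=
  \sum_(a < d) delta_mx (ordS a) a.

Definition cinc (R : realType) (d N : nat) (i j : 'I_N) : qop R d N :=
  cgate [set i] j (Xgate R d).

(* circuit k W: W is a product of single-qudit gates and CINC gates in which
   exactly k factors are CINC gates. *)
Inductive circuit (R : realType) (d N : nat) : nat -> qop R d N -> Prop :=
| circuit_id : circuit 0 1%:M
| circuit_single (k : nat) (W : qop R d N) (j : 'I_N) (V : 'M[R[i]]_d) :
    V \is unitarymx -> circuit k W -> circuit k (single j V *m W)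
| circuit_cinc (k : nat) (W : qop R d N) (i j : 'I_N) :
    i != j -> circuit k W -> circuit k.+1 (cinc R d i j *m W).

(* psi (x) phi, where phi is the state of the last of the N.+1 qudits; the
   first N qudits are the indices lift ord_max i = i. *)
Definition tens (R : realType) (d N : nat) (psi : qstate R d N)
    (phi : 'cV[R[i]]_d) : qstate R d N.+1 :=
  \col_k (let y := enum_val k : cfg d N.+1 in
          psi (enum_rank ([ffun i => y (lift ord_max i)] : cfg d N)) 0
          * phi (y ord_max) 0).

Definition ket0 (R : realType) (d : nat) : 'cV[R[i]]_d :=
  \col_a (a == 0 :> nat)%:R.

(* Integer-valued because for d >= 4 an intermediate difference can be
   negative (already for d = 4, n = 7). *)
Definition NSU (d n : nat) : int :=
  if d == 2 then 16 * n%:Z - 48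
  else if d == 3 then 32 * n%:Z - 160
  else (32 * d%:Z - 40) * n%:Z - 192 * d%:Z + 272.

(* Main.v *)
Require Import Defs.
From mathcomp Require Import all_boot all_order all_algebra.
From mathcomp.algebra Require Import spectral.
From mathcomp.real_closed Require Import complex.
From mathcomp Require Import reals trigo zify.
Import Order.TTheory GRing.Theory Num.Theory.
Local Open Scope ring_scope.
Local Open Scope complex_scope.

(* Up to conjugation by single-qudit gates, an element of SU(d) is a commutator
   A X A^-1 X^-1 with A diagonal, and X^-1 is conjugate to X. So a controlled
   U costs 2 CINC gates and a doubly controlled U costs 8, for every d.

   The conjunction of the controls is computed with conditionally clean qudits.
   Once the ancilla has recorded that the first two controls hold d-1, these
   two can be treated as clean workspace with known content d-1: if the record
   is negative, the final gate does not fire and everything is undone. Applied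
   recursively, this uses n-2 doubly controlled gates to reduce the n-1 controls
   to two, hence 16(n-2) + 8 CINC gates in all, which is at most 2 N_SU(d,n). *)

Set Implicit Arguments.
Unset Strict Implicit.
Unset Printing Implicit Defensive.

(** * Unitary matrices, and commutators with the cyclic shift *)

Section UnitaryMatrices.
Variables (R : realType) (d : nat).
Implicit Types (U V Q : 'M[R[i]]_d) (r : 'rV[R[i]]_d) (c : R[i]).

Lemma invmx_unitarymx U : U \is unitarymx -> invmx U \is unitarymx.
Proof. by move=> uU; rewrite invmx_unitary // trmxC_unitary. Qed.

Lemma scale_unitarymx c U :
  `|c| = 1 -> U \is unitarymx -> c *: U \is unitarymx.
Proof.
move=> c1 /unitarymxP UU; apply/unitarymxP.
rewrite linearZ /= map_mxZ -scalemxAl -scalemxAr UU scalerA -normCK c1.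
by rewrite expr1n scale1r.
Qed.

Lemma norm_det_unitarymx U : U \is unitarymx -> `|\det U| = 1.
Proof.
move=> /unitarymxP /(congr1 determinant).
rewrite det_mulmx det_map_mx det_tr det1 -normCK => /eqP.
by rewrite sqrp_eq1 // => /eqP.
Qed.

Lemma diag_unitarymxP r :
  reflect (forall k, `|r 0 k| = 1) (diag_mx r \is unitarymx).
Proof.
apply: (iffP idP) => [|r1].
  move=> /unitarymxP rr k; have := congr1 (fun M : 'M_d => M k k) rr.
  rewrite tr_diag_mx map_diag_mx mulmx_diag !mxE eqxx !mulr1n -normCK.
  by move/eqP; rewrite sqrp_eq1 // => /eqP.
apply/unitarymxP; rewrite tr_diag_mx map_diag_mx mulmx_diag.
apply/matrixP => k l; rewrite !mxE -normCK r1 expr1n.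
by case: eqP.
Qed.

(** A unitary matrix is normal, so the spectral theorem applies. The diagonal factor is then a
    product of unitaries, which puts its entries on the unit circle. *)
Lemma unitarymx_spectral U : U \is unitarymx ->
  exists Q r, [/\ Q \is unitarymx, forall k, `|r 0 k| = 1 &
                  U = Q *m diag_mx r *m invmx Q].
Proof.
move=> uU; have uS := spectral_unitarymx U.
have nU : U \is normalmx.
  apply/normalmxP; rewrite (unitarymxP uU).
  by rewrite -invmx_unitary // mulVmx // unitarymx_unit.
have /orthomx_spectralP UE := nU.
exists (invmx (spectralmx U)), (spectral_diag U); split=> //.
- exact: invmx_unitarymx.
- apply/diag_unitarymxP.
  have -> : diag_mx (spectral_diag U) =
      spectralmx U *m U *m invmx (spectralmx U).
    rewrite [X in _ *m X *m _]UE !mulmxA mulmxV ?unitarymx_unit // mul1mx.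
    by rewrite -mulmxA mulmxV ?unitarymx_unit // mulmx1.
  by rewrite !mul_unitarymx ?invmx_unitarymx.
- by rewrite invmxK.
Qed.

(** The phase is a [d]-th root of the determinant, since scaling by [c] multiplies the determinant
    by [c ^+ d]. *)
Lemma unitarymx_phase U : (0 < d)%N -> U \is unitarymx ->
  exists c V, [/\ `|c| = 1, V \is unitarymx, \det V = 1 & U = c *: V].
Proof.
move=> d0 uU; pose c := d.-root (\det U).
have c1 : `|c| = 1 by rewrite norm_rootC norm_det_unitarymx // rootC1.
have c0 : c != 0 by rewrite -normr_eq0 c1 oner_eq0.
exists c, (c^-1 *: U); split=> //.
- by rewrite scale_unitarymx // normfV c1 invr1.
- rewrite detZ exprVn rootCK // mulVf //.
  by rewrite -normr_eq0 norm_det_unitarymx // oner_eq0.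
- by rewrite scalerA divff // scale1r.
Qed.

Lemma Xgate_matrixE : Xgate R d = \matrix_(i, j) (i == ordS j)%:R.
Proof.
apply/matrixP => i j; rewrite /Xgate summxE mxE (bigD1 j) //= big1 ?addr0.
  by rewrite mxE eqxx andbT.
by move=> k kj; rewrite mxE [j == k]eq_sym (negPf kj) andbF.
Qed.

Lemma Xgate_unitarymx : Xgate R d \is unitarymx.
Proof.
rewrite -trmxC_unitary Xgate_matrixE; apply/unitarymxP/matrixP => i j.
rewrite !mxE (bigD1 (ordS i)) //= big1 ?addr0 => [|k ki].
  by rewrite !mxE eqxx conjC1 mul1r conjCK (inj_eq (@ordS_inj d)).
by rewrite !mxE (negPf ki) conjC0 mul0r.
Qed.

(* Hence a controlled [X^-1] costs one CINC rather than [d - 1]. *)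
Lemma Xgate_inv_conj : exists2 Q, Q \is unitarymx &
  invmx (Xgate R d) = Q *m Xgate R d *m invmx Q.
Proof.
(* Reversing the basis, a -> d-1-a, exchanges cyclic successor and predecessor; [Q] is the matrix of
   this involution. *)
pose Q : 'M[R[i]]_d := \matrix_(i, j) (i == rev_ord j)%:R.
have QM (M : 'M[R[i]]_d) i j : (Q *m M) i j = M (rev_ord i) j.
  rewrite mxE (bigD1 (rev_ord i)) //= big1 ?addr0 => [|k ki].
    by rewrite mxE rev_ordK eqxx mul1r.
  rewrite mxE; case: eqP => [ik|]; last by rewrite mul0r.
  by rewrite ik rev_ordK eqxx in ki.
have Qt : (Q^t*)%sesqui = Q.
  apply/matrixP => i j; rewrite !mxE.
  rewrite -[X in X == _]rev_ordK (inj_eq (inv_inj (@rev_ordK d))) [rev_ord _ == _]eq_sym.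
  by case: eqP; rewrite ?conjC0 ?conjC1.
have QQ : Q *m Q = 1%:M.
  by apply/matrixP => i j; rewrite QM !mxE (inj_eq (inv_inj (@rev_ordK d))).
have uQ : Q \is unitarymx by apply/unitarymxP; rewrite Qt.
have Qi : invmx Q = Q by rewrite invmx_unitary.
have rotK j : rev_ord (ordS (rev_ord (ordS j))) = j :> 'I_d.
  apply: val_inj => /=; have jd := ltn_ord j.
  have [jd1|jd1] := eqVneq j.+1 d.
    rewrite jd1 modnn subn1 prednK ?modnn ?subn1; first by rewrite -[d in LHS]jd1.
    exact: leq_ltn_trans jd.
  have jd' : (j.+1 < d)%N by rewrite ltn_neqAle jd1.
  rewrite (modn_small jd') -subSn // subSS modn_small.
    by rewrite subnS subKn // ltnW.
  by rewrite ltn_subrL (leq_ltn_trans _ jd).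
have uX := unitarymx_unit Xgate_unitarymx.
exists Q => //; rewrite Qi; apply: (can_inj (mulmxK uX)); rewrite mulVmx //.
apply/matrixP => i j; rewrite -!mulmxA QM.
rewrite Xgate_matrixE [RHS]mxE (bigD1 (rev_ord (ordS j))) //= big1 ?addr0 => [|k kj].
  rewrite !QM !mxE rev_ordK eqxx mulr1.
  by rewrite -[in RHS](inj_eq (inv_inj (@rev_ordK d))) rotK rev_ordK.
rewrite !QM !mxE mulrC; case: eqP; rewrite ?mul0r // => kE.
by rewrite -kE rev_ordK eqxx in kj.
Qed.

(* [A] is the diagonal matrix of the partial products of the entries of [r]. *)
Lemma diag_mx_commutator r : (forall k, `|r 0 k| = 1) -> \prod_k r 0 k = 1 ->
  exists2 A, A \is unitarymx &
    diag_mx r = A *m Xgate R d *m (invmx A *m invmx (Xgate R d)).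
Proof.
move=> r1 rP; pose p := \row_(k < d) \prod_(l < d | (l <= k)%N) r 0 l.
have uA : diag_mx p \is unitarymx.
  by apply/diag_unitarymxP => k; rewrite mxE normr_prod big1.
exists (diag_mx p) => //.
(* At the wrap-around k = d-1 this relation holds because the full product [p 0 k] is 1. *)
have pS k : p 0 (ordS k) = r 0 (ordS k) * p 0 k.
  rewrite !mxE; have kd := ltn_ord k.
  have [kd1|kd1] := eqVneq k.+1 d.
    rewrite [X in _ = _ * X](eq_bigl xpredT) ?rP ?mulr1 => [|l].
      rewrite (big_pred1 (ordS k)) // => l /=.
      by rewrite -val_eqE /= kd1 modnn leqn0.
    by rewrite -ltnS kd1 ltn_ord.
  have kd' : (k.+1 < d)%N by rewrite ltn_neqAle kd1.
  rewrite (bigD1 (ordS k)) ?leqnn //=; congr (_ * _); apply: eq_bigl => l.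
  by rewrite -val_eqE /= modn_small // -[RHS]ltnS ltn_neqAle andbC.
have uX := unitarymx_unit Xgate_unitarymx; have uA' := unitarymx_unit uA.
(* With the inverses cleared the goal is r X A = A X, whose only nontrivial entries, at i =
   [ordS j], are given by [pS]. *)
apply: (can_inj (mulmxK uX)); rewrite !mulmxA mulmxKV //.
apply: (can_inj (mulmxK uA')); rewrite mulmxKV //.
rewrite Xgate_matrixE; apply/matrixP => i j.
rewrite !mul_diag_mx mul_mx_diag !mxE.
case: eqP => [->|_]; last by rewrite !mulr0 mul0r.
by move: (pS j); rewrite !mxE !mulr1.
Qed.

(** After diagonalisation, determinant 1 says that the eigenvalues multiply to 1, as
    [diag_mx_commutator] requires. *)
Lemma SU_commutator U : U \is unitarymx -> \det U = 1 ->
  exists Q A, [/\ Q \is unitarymx, A \is unitarymx &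
    U = Q *m (A *m Xgate R d *m (invmx A *m invmx (Xgate R d))) *m invmx Q].
Proof.
move=> uU; have [Q [r [uQ r1 ->]]] := unitarymx_spectral uU.
have uQ' := unitarymx_unit uQ.
rewrite !det_mulmx mulrAC -det_mulmx mulmxV // det1 mul1r det_diag => rP.
have [A uA ->] := diag_mx_commutator r1 rP.
by exists Q, A.
Qed.

End UnitaryMatrices.

(** * Controlled gates and their CINC cost *)

Section Gates.
Variables (R : realType) (d N : nat).
Implicit Types (U V Q : 'M[R[i]]_d) (j p q : 'I_N) (x : cfg d N).
Implicit Types (F G : cfg d N -> 'M[R[i]]_d) (b : pred (cfg d N)).

Lemma upd_id x j : upd x j (x j) = x.
Proof. by apply/ffunP => k; rewrite ffunE; case: eqP => [->|]. Qed.

Lemma updE x j a k : upd x j a k = if k == j then a else x k.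
Proof. by rewrite ffunE. Qed.

Lemma upd_upd x j a c : upd (upd x j a) j c = upd x j c.
Proof. by apply/ffunP => k; rewrite !ffunE; case: eqP. Qed.

Lemma upd_comm x j k a c : j != k ->
  upd (upd x j a) k c = upd (upd x k c) j a.
Proof.
move=> jk; apply/ffunP => l; rewrite !ffunE.
by case: (l =P k) => // ->; rewrite eq_sym (negPf jk).
Qed.

Lemma mulmx_ket (M : qop R d N) x : M *m ket R x = col (enum_rank x) M.
Proof. by rewrite -colE. Qed.

Lemma qopP (A B : qop R d N) :
  (forall x, A *m ket R x = B *m ket R x) -> A = B.
Proof.
move=> AB; apply/matrixP => k l.
by have /colP/(_ k) := AB (enum_val l); rewrite !mulmx_ket !mxE enum_valK.
Qed.

Lemma apply_at_diag (r : 'rV[R[i]]_d) j x :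
  apply_at (diag_mx r) j x = r 0 (x j) *: ket R x.
Proof.
rewrite /apply_at (bigD1 (x j)) //= big1 ?addr0 => [|a aj].
  by rewrite mxE eqxx mulr1n upd_id.
by rewrite mxE (negPf aj) mulr0n scale0r.
Qed.

Lemma apply_at_scalar c j x : apply_at c%:M j x = c *: ket R x.
Proof. by rewrite -diag_const_mx apply_at_diag mxE. Qed.

Lemma apply_at1 j x : apply_at 1%:M j x = ket R x.
Proof. by rewrite apply_at_scalar scale1r. Qed.

(* The uniformly controlled gate applying [F x] to qudit [j] of [|x>],
   meaningful when [F x] does not depend on [x j]. *)
Definition ugate j F : qop R d N :=
  \matrix_(k, l) apply_at (F (enum_val l)) j (enum_val l) k 0.

(** A second gate on the same target meets labels whose qudit [j] has already changed. Blocks blind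
    to [j] therefore compose pointwise. *)
Definition indep T j (f : cfg d N -> T) := forall x a, f (upd x j a) = f x.

Lemma ugate_ket j F x : ugate j F *m ket R x = apply_at (F x) j x.
Proof. by rewrite mulmx_ket; apply/colP => k; rewrite !mxE enum_rankK. Qed.

Lemma eq_ugate j F G : F =1 G -> ugate j F = ugate j G.
Proof. by move=> FG; apply: qopP => x; rewrite !ugate_ket FG. Qed.

Lemma ugate_apply_at j F V x : indep j F ->
  ugate j F *m apply_at V j x = apply_at (F x *m V) j x.
Proof.
move=> Fj; rewrite /apply_at mulmx_sumr.
under eq_bigr => a _ do rewrite -scalemxAr ugate_ket /apply_at scaler_sumr.
rewrite exchange_big; apply: eq_bigr => c _ /=.
rewrite mxE scaler_suml; apply: eq_bigr => a _.
by rewrite scalerA Fj upd_upd !updE eqxx mulrC.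
Qed.

Lemma ugateM j F G : indep j F ->
  ugate j F *m ugate j G = ugate j (fun x => F x *m G x).
Proof.
by move=> Fj; apply: qopP => x; rewrite -mulmxA !ugate_ket ugate_apply_at.
Qed.

Definition cond (b : bool) U : 'M[R[i]]_d := if b then U else 1%:M.

Definition on (a : 'I_d) := a == d.-1 :> nat.

Lemma indep_cond j b U : indep j b -> indep j (fun x => cond (b x) U).
Proof. by move=> bj x a; rewrite bj. Qed.

Lemma indep_on i j : i != j -> indep j (fun x => on (x i)).
Proof. by move=> ij x a; rewrite updE (negPf ij). Qed.

Lemma forall_on_set1 i x : [forall k in [set i], on (x k)] = on (x i).
Proof.
apply/forall_inP/idP => [|xi k /set1P -> //]; by apply; rewrite set11.
Qed.

Lemma cgate_ugate (S : {set 'I_N}) j U :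
  cgate S j U = ugate j (fun x => cond [forall i in S, on (x i)] U).
Proof.
apply/matrixP => k l; rewrite !mxE /cond.
by case: ifP => _; rewrite ?apply_at1.
Qed.

Lemma cgate_ket (S : {set 'I_N}) j U x : cgate S j U *m ket R x =
  if [forall i in S, on (x i)] then apply_at U j x else ket R x.
Proof.
by rewrite cgate_ugate ugate_ket /cond; case: ifP; rewrite ?apply_at1.
Qed.

Lemma circuit_mul k l (W V : qop R d N) :
  circuit k W -> circuit l V -> circuit (k + l) (W *m V).
Proof.
move=> cW cV; elim: cW => [|m W' j A uA _|m W' i j ij _].
- by rewrite mul1mx.
- by rewrite -mulmxA; apply: circuit_single.
- by rewrite -mulmxA; apply: circuit_cinc.
Qed.

Lemma circuit_ugateM k l j F G : indep j F ->
  circuit k (ugate j F) -> circuit l (ugate j G) ->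
  circuit (k + l) (ugate j (fun x => F x *m G x)).
Proof. by move=> Fj cF cG; rewrite -ugateM //; apply: circuit_mul. Qed.

Lemma circuit_const j V : V \is unitarymx -> circuit 0 (ugate j (fun=> V)).
Proof.
by move=> uV; rewrite -[ugate _ _]mulmx1; exact: circuit_single (circuit_id _ _ _).
Qed.

Lemma circuit_condM k l j b U V : indep j b ->
  circuit k (ugate j (fun x => cond (b x) U)) ->
  circuit l (ugate j (fun x => cond (b x) V)) ->
  circuit (k + l) (ugate j (fun x => cond (b x) (U *m V))).
Proof.
move=> bj cU cV; have := circuit_ugateM (indep_cond _ bj) cU cV.
congr circuit; apply: eq_ugate => x; rewrite /cond.
by case: ifP; rewrite ?mulmx1.
Qed.

(** The conjugating gates cancel when the condition fails, so they can stay uncontrolled and cost no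
    CINC. *)
Lemma circuit_cond_conj k j b U Q : indep j b -> Q \is unitarymx ->
  circuit k (ugate j (fun x => cond (b x) U)) ->
  circuit k (ugate j (fun x => cond (b x) (Q *m U *m invmx Q))).
Proof.
move=> bj uQ cU; have cQ := circuit_const j uQ.
have := circuit_ugateM _ cQ (circuit_ugateM (indep_cond _ bj) cU
  (circuit_const j (invmx_unitarymx uQ))).
rewrite addn0 => /(_ (fun _ _ => erefl)); congr circuit.
apply: eq_ugate => x; rewrite /cond mulmxA.
by case: ifP => // _; rewrite mulmx1 mulmxV // unitarymx_unit.
Qed.

Lemma circuit_cX i j : i != j ->
  circuit 1 (ugate j (fun x => cond (on (x i)) (Xgate R d))).
Proof.
move=> ij; have := circuit_cinc ij (circuit_id R d N).
rewrite mulmx1 /cinc cgate_ugate; congr circuit; apply: eq_ugate => x.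
by rewrite forall_on_set1.
Qed.

Lemma circuit_cXV i j : i != j ->
  circuit 1 (ugate j (fun x => cond (on (x i)) (invmx (Xgate R d)))).
Proof.
move=> ij; have [Q uQ ->] := Xgate_inv_conj R d.
by apply: circuit_cond_conj => //; [exact: indep_on | exact: circuit_cX].
Qed.

(** Group the commutator as (A X A^-1) X^-1: both factors are conjugates of X, hence one CINC
    each. *)
Lemma circuit_cSU i j U : i != j -> U \is unitarymx -> \det U = 1 ->
  circuit 2 (ugate j (fun x => cond (on (x i)) U)).
Proof.
move=> ij uU dU; have [Q [A [uQ uA ->]]] := SU_commutator uU dU.
apply: circuit_cond_conj => //; first exact: indep_on.
rewrite mulmxA.
apply: (@circuit_condM 1 1); [exact: indep_on | | exact: circuit_cXV].
by apply: circuit_cond_conj => //; [exact: indep_on | exact: circuit_cX].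
Qed.

(* A phase conditioned on qudit [i] can be regarded as acting on any qudit. *)
Lemma ugate_phase i j b c :
  ugate i (fun x => cond (b x) (diag_mx (\row_a if on a then c else 1))) =
  ugate j (fun x => (if b x && on (x i) then c else 1)%:M).
Proof.
apply: qopP => x; rewrite !ugate_ket apply_at_scalar /cond.
by case: (b x); rewrite ?apply_at1 ?scale1r // apply_at_diag mxE.
Qed.

Lemma diag_phase_unitarymx (c : R[i]) : `|c| = 1 ->
  diag_mx (\row_(a < d) if on a then c else 1) \is unitarymx.
Proof.
by move=> c1; apply/diag_unitarymxP => a; rewrite mxE; case: ifP; rewrite ?normr1.
Qed.

(** Split U = c V with det V = 1. The conditional phase c moves from the target to the control [i],
    where it is a diagonal gate with one control fewer. *)
Lemma circuit_cond_phase k l i j b U : (0 < d)%N -> indep j b ->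
    indep j (fun x => on (x i)) -> U \is unitarymx ->
  (forall c, `|c| = 1 -> circuit k
    (ugate i (fun x => cond (b x) (diag_mx (\row_a if on a then c else 1))))) ->
  (forall V, V \is unitarymx -> \det V = 1 ->
    circuit l (ugate j (fun x => cond (b x && on (x i)) V))) ->
  circuit (k + l) (ugate j (fun x => cond (b x && on (x i)) U)).
Proof.
move=> d0 bj ij uU cphase cSU.
have [c [V [c1 uV dV ->]]] := unitarymx_phase d0 uU.
have := cphase c c1; rewrite (ugate_phase i j) => cc.
have cI : indep j (fun x => (if b x && on (x i) then c else 1)%:M : 'M[R[i]]_d).
  by move=> x a; rewrite bj ij.
have := circuit_ugateM cI cc (cSU V uV dV).
congr circuit; apply: eq_ugate => x; rewrite /cond.
by case: ifP => _; rewrite ?mul1mx ?mul_scalar_mx.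
Qed.

Lemma circuit_cU i j U : (0 < d)%N -> i != j -> U \is unitarymx ->
  circuit 2 (ugate j (fun x => cond (on (x i)) U)).
Proof.
move=> d0 ij uU.
(* Without a further condition the phase is a free single-qudit gate on the control. *)
apply: (@circuit_cond_phase 0 2 i j xpredT) => // [|c c1|V uV dV].
- exact: indep_on.
- exact: circuit_const (diag_phase_unitarymx c1).
- exact: circuit_cSU.
Qed.

(** Let [p] control A and A^-1, and let [q] control X and X^-1. The commutator collapses to 1 unless
    both controls are on. The cost is 2 + 1 + 2 + 1. *)
Lemma circuit_ccSU p q j U : (0 < d)%N -> p != j -> q != j ->
  U \is unitarymx -> \det U = 1 ->
  circuit 6 (ugate j (fun x => cond (on (x p) && on (x q)) U)).
Proof.
move=> d0 pj qj uU dU; have [Q [A [uQ uA ->]]] := SU_commutator uU dU.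
have [bp bq] : indep j (fun x => on (x p)) /\ indep j (fun x => on (x q)).
  by split; apply: indep_on.
apply: circuit_cond_conj => // [x a|]; first by rewrite bp bq.
have c1 := circuit_ugateM (indep_cond _ bp) (circuit_cU d0 pj uA) (circuit_cX qj).
have c2 := circuit_ugateM (indep_cond _ bp)
  (circuit_cU d0 pj (invmx_unitarymx uA)) (circuit_cXV qj).
have cI : indep j (fun x => cond (on (x p)) A *m cond (on (x q)) (Xgate R d)).
  by move=> x a; rewrite bp bq.
have := circuit_ugateM cI c1 c2.
congr circuit; apply: eq_ugate => x; rewrite /cond.
case: (on (x p)); case: (on (x q)); rewrite ?mulmx1 ?mul1mx //.
- by rewrite mulmxV // unitarymx_unit.
- by rewrite mulmxV // unitarymx_unit // Xgate_unitarymx.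
Qed.

(** The phase becomes a diagonal gate on [q] controlled by [p], adding 2 to the 6 of the special
    unitary part. *)
Lemma circuit_ccU p q j U : (0 < d)%N -> p != q -> p != j -> q != j ->
  U \is unitarymx ->
  circuit 8 (ugate j (fun x => cond (on (x p) && on (x q)) U)).
Proof.
move=> d0 pq pj qj uU.
apply: (@circuit_cond_phase 2 6) => // [||c c1|V uV dV].
- exact: indep_on.
- exact: indep_on.
- exact: circuit_cU d0 pq (diag_phase_unitarymx c1).
- exact: circuit_ccSU.
Qed.

(** Reverse the factors. Since an inverted CINC again costs one, uncomputing is as cheap as
    computing. *)
Lemma circuit_inv k (W : qop R d N) : (0 < d)%N -> circuit k W ->
  exists2 W', circuit k W' & W' *m W = 1%:M.
Proof.
move=> d0; have ugate1 j : ugate j (fun=> 1%:M) = 1%:M.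
  by apply: qopP => x; rewrite ugate_ket apply_at1 mul1mx.
elim=> [|l V j A uA _ [V' cV' VV]|l V i j ij _ [V' cV' VV]].
- by exists 1%:M; rewrite ?mulmx1 //; exact: circuit_id.
- exists (V' *m ugate j (fun=> invmx A)).
    by rewrite -[l]addn0; apply: circuit_mul (circuit_const _ (invmx_unitarymx uA)).
  rewrite mulmxA -[V' *m _ *m _]mulmxA [ugate _ _ *m _]ugateM // mulVmx ?ugate1 ?mulmx1 //.
  exact: unitarymx_unit.
- exists (V' *m ugate j (fun x => cond (on (x i)) (invmx (Xgate R d)))).
    by rewrite -addn1; apply: circuit_mul (circuit_cXV ij).
  rewrite mulmxA -[V' *m _ *m _]mulmxA /cinc cgate_ugate ugateM.
    rewrite -[RHS]VV; congr (_ *m _); rewrite -[RHS]mulmx1; congr (_ *m _).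
    rewrite -(ugate1 j); apply: eq_ugate => x.
    rewrite forall_on_set1 /cond; case: ifP; rewrite ?mulmx1 // mulVmx //.
    exact: unitarymx_unit (Xgate_unitarymx R d).
  by apply: indep_cond; apply: indep_on.
Qed.

End Gates.

(** * The conjunction of the controls, on basis labels *)

Section Ladder.
Variables (d N : nat).
Implicit Types (p q j r : 'I_N) (s : seq 'I_N) (x : cfg d N).

(* If qudit [j] is known to hold [d-1], this computes into it whether qudits
   [p] and [q] both hold [d-1]. *)
Definition step p q j x : cfg d N :=
  if on (x p) && on (x q) then x else upd x j (ordS (x j)).

Lemma step_other p q j x r : r != j -> step p q j x r = x r.
Proof. by move=> rj; rewrite /step; case: ifP; rewrite ?updE ?(negPf rj). Qed.

Lemma step_upd p q j x r a : r \notin [:: p; q; j] ->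
  step p q j (upd x r a) = upd (step p q j x) r a.
Proof.
rewrite !inE !negb_or => /and3P[rp rq rj].
rewrite /step !updE ![_ == r]eq_sym (negPf rp) (negPf rq) (negPf rj).
by case: ifP => // _; rewrite upd_comm.
Qed.

(** The increment wraps d-1 to 0, which differs from d-1 because d > 1. *)
Lemma on_step p q j x : (1 < d)%N -> on (x j) ->
  on (step p q j x j) = on (x p) && on (x q).
Proof.
move=> d1 xj; rewrite /step; case: ifP => // _.
rewrite updE eqxx /on /= (eqP xj) prednK ?modnn; last exact: ltnW.
by case: (d) d1 => [|[]].
Qed.

(* If [g0] and [g1] hold [d-1], [ladder g0 g1 s] computes into [g1] whether all
   of [s] hold [d-1]. Once [r1] and [r2] have been recorded in [g0], they can
   be taken to hold [d-1] themselves: otherwise [g0] already forces the answer. *)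
Fixpoint ladder g0 g1 s x : cfg d N :=
  match s with
  | [::] => x
  | [:: r] => step g0 r g1 x
  | r1 :: r2 :: s' => step g0 r2 g1 (ladder r1 r2 s' (step r1 r2 g0 x))
  end.

Lemma ladder_other g0 g1 s x r :
  r \notin [:: g0, g1 & s] -> ladder g0 g1 s x r = x r.
Proof.
(* [ladder] consumes two list elements per call, hence induction on a bound for the size. *)
have [m] := ubnP (size s); elim: m g0 g1 s x => // m IH g0 g1 [|r1 [|r2 s]] x //=.
  by rewrite !inE !negb_or => _ /and3P[_ rg _]; rewrite step_other.
rewrite ltnS => /ltnW sm; rewrite !inE !negb_or => /and5P[r0 rg r1n r2n rs].
by rewrite step_other // IH ?step_other // !inE !negb_or r1n r2n.
Qed.

Lemma ladder_upd g0 g1 s x r a : r \notin [:: g0, g1 & s] ->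
  ladder g0 g1 s (upd x r a) = upd (ladder g0 g1 s x) r a.
Proof.
have [m] := ubnP (size s); elim: m g0 g1 s x => // m IH g0 g1 [|r1 [|r2 s]] x //=.
  rewrite !inE !negb_or => _ /and3P[r0 rg rr].
  by rewrite step_upd // !inE !negb_or r0 rr rg.
rewrite ltnS => /ltnW sm; rewrite !inE !negb_or => /and5P[r0 rg r1n r2n rs].
rewrite step_upd ?IH ?step_upd // ?inE ?negb_or ?r0 ?rg ?r1n ?r2n //.
Qed.

Lemma on_ladder g0 g1 s x : (1 < d)%N -> uniq [:: g0, g1 & s] ->
  on (x g0) -> on (x g1) ->
  on (ladder g0 g1 s x g1) = all (fun i => on (x i)) s.
Proof.
move=> d1; have [m] := ubnP (size s).
elim: m g0 g1 s x => // m IH g0 g1 [|r1 [|r2 s]] x /=.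
- by move=> _ _ _ ->.
- by move=> _ _ x0 x1; rewrite on_step // x0 andbT.
rewrite ltnS => /ltnW sm.
rewrite !inE !negb_or.
move=> /and5P[/and4P[g01 g0r1 g0r2 g0s] /and3P[g1r1 g1r2 g1s]].
move=> /andP[r12 r1s] r2s us x0 x1.
set y := step r1 r2 g0 x.
have y1 : y g1 = x g1 by rewrite step_other // eq_sym.
have z0 : ladder r1 r2 s y g0 = y g0.
  by rewrite ladder_other // !inE !negb_or g0r1 g0r2.
have z1 : ladder r1 r2 s y g1 = y g1.
  by rewrite ladder_other // !inE !negb_or g1r1 g1r2.
rewrite on_step // ?z1 ?y1 // z0 on_step // andbA.
case: (boolP (on (x r1) && on (x r2))) => //= x12.
have -> : y = x by rewrite /y /step x12.
case/andP: x12 => ? ?.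
by rewrite IH //= inE negb_or r12 r1s r2s us.
Qed.

End Ladder.

(** * Circuits realising maps of basis labels *)

Section Computes.
Variables (R : realType) (d N : nat).
Implicit Types (p q j t : 'I_N) (x : cfg d N) (f h : cfg d N -> cfg d N).

Definition computes k f :=
  exists2 W : qop R d N, circuit k W & forall x, W *m ket R x = ket R (f x).

Lemma computes_id : computes 0 id.
Proof. by exists 1%:M => [|x]; [exact: circuit_id | rewrite mul1mx]. Qed.

Lemma computes_comp k l f h :
  computes k f -> computes l h -> computes (k + l) (f \o h).
Proof.
move=> [V cV Vf] [W cW Wg]; exists (V *m W); first exact: circuit_mul.
by move=> x; rewrite -mulmxA Wg Vf.
Qed.

Lemma apply_at_X j x : apply_at (Xgate R d) j x = ket R (upd x j (ordS (x j))).
Proof.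
rewrite /apply_at Xgate_matrixE (bigD1 (ordS (x j))) //= big1 ?addr0 => [|a aj].
  by rewrite mxE eqxx scale1r.
by rewrite mxE (negPf aj) scale0r.
Qed.

(** This serves to bring the ancilla from 0 to d-1 without any CINC. *)
Lemma computes_pred j : computes 0 (fun x => upd x j (ord_pred (x j))).
Proof.
exists (ugate j (fun=> invmx (Xgate R d))).
  exact: circuit_const (invmx_unitarymx (Xgate_unitarymx R d)).
move=> x; rewrite -[in LHS](upd_id x j) -[x j in LHS]ord_predK.
have -> : upd x j (ordS (ord_pred (x j))) =
  upd (upd x j (ord_pred (x j))) j (ordS (upd x j (ord_pred (x j)) j)).
  by rewrite upd_upd updE eqxx.
rewrite -apply_at_X ugate_apply_at // mulVmx ?apply_at1 //.
exact: unitarymx_unit (Xgate_unitarymx R d).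
Qed.

(** Increment unconditionally, then undo it by a doubly controlled X^-1 when both controls are
    on. *)
Lemma computes_step p q j : (0 < d)%N -> uniq [:: p; q; j] ->
  computes 8 (step p q j).
Proof.
move=> d0 /=; rewrite !inE negb_or => /and3P[/andP[pq pj] qj _].
have uX := Xgate_unitarymx R d.
exists (ugate j (fun x => cond (on (x p) && on (x q)) (invmx (Xgate R d)))
        *m ugate j (fun=> Xgate R d)).
  by apply: (@circuit_mul _ _ _ 8 0);
    [apply: circuit_ccU; rewrite ?invmx_unitarymx | apply: circuit_const].
move=> x; rewrite -mulmxA ugate_ket ugate_apply_at /cond /step.
  case: ifP => _; last by rewrite mul1mx apply_at_X.
  by rewrite mulVmx ?apply_at1 // unitarymx_unit.
by move=> y a; rewrite !updE (negPf pj) (negPf qj).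
Qed.

(** Each recursive call spends two steps on two list elements, and a last single element takes one
    step: 8 CINC per element. *)
Lemma computes_ladder g0 g1 s : (0 < d)%N -> uniq [:: g0, g1 & s] ->
  computes (8 * size s) (ladder g0 g1 s).
Proof.
move=> d0; have [m] := ubnP (size s).
elim: m g0 g1 s => // m IH g0 g1 [|r1 [|r2 s]].
- by move=> _ _; exact: computes_id.
- move=> _ /=; rewrite !inE !negb_or => /and3P[/andP[g01 g0r] g1r _].
  by apply: computes_step => //=; rewrite !inE negb_or g0r g01 eq_sym g1r.
rewrite /= ltnS => /ltnW sm.
rewrite !inE !negb_or.
move=> /and5P[/and4P[g01 g0r1 g0r2 g0s] /and3P[g1r1 g1r2 g1s]].
move=> /andP[r12 r1s] r2s us.
have -> : (8 * (size s).+2 = 8 + (8 * size s + 8))%N.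
  by rewrite !mulnS [(8 * size s + 8)%N]addnC.
apply: (computes_comp (f := step g0 r2 g1) (h := ladder r1 r2 s \o step r1 r2 g0)).
  by apply: computes_step => //=; rewrite !inE negb_or g0r2 g01 eq_sym g1r2.
apply: computes_comp.
  by apply: IH => //=; rewrite inE negb_or r12 r1s r2s us.
apply: computes_step => //=; rewrite !inE negb_or r12.
by rewrite ![_ == g0]eq_sym g0r1 g0r2.
Qed.

(** Compute, fire, uncompute. As [f] neither reads nor alters qudit [t], the uncomputation still
    works after [U] has changed that qudit. *)
Lemma circuit_computes_conj k f p q t (U : 'M[R[i]]_d) :
    (0 < d)%N -> uniq [:: p; q; t] -> U \is unitarymx -> computes k f ->
    (forall x, f x t = x t) ->
    (forall x a, f (upd x t a) = upd (f x) t a) ->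
  exists2 W : qop R d N, circuit (k + (8 + k)) W &
    forall x, W *m ket R x =
      if on (f x p) && on (f x q) then apply_at U t x else ket R x.
Proof.
move=> d0 /=; rewrite !inE negb_or => /and3P[/andP[pq pt] qt _] uU [L cL Lf] ft fu.
have [L' cL' LL] := circuit_inv d0 cL.
have L'f x : L' *m ket R (f x) = ket R x by rewrite -Lf mulmxA LL mul1mx.
exists (L' *m (ugate t (fun x => cond (on (x p) && on (x q)) U) *m L)).
  by do 2!apply: circuit_mul => //; apply: circuit_ccU.
move=> x; rewrite -!mulmxA Lf ugate_ket /cond.
case: ifP => _; last by rewrite apply_at1.
rewrite /apply_at mulmx_sumr; apply: eq_bigr => a _.
by rewrite -scalemxAr -fu L'f ft.
Qed.

End Computes.

(** * Adjoining an ancilla in a basis state *)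

Section CleanAncilla.
Variables (R : realType) (d N : nat).
Implicit Types (x : cfg d N) (o a : 'I_d).

Definition ext x o : cfg d N.+1 :=
  [ffun i => if unlift ord_max i is Some k then x k else o].

Lemma ext_lift x o k : ext x o (lift ord_max k) = x k.
Proof. by rewrite ffunE liftK. Qed.

Lemma ext_max x o : ext x o ord_max = o.
Proof. by rewrite ffunE unlift_none. Qed.

Lemma ext_upd x o t a : ext (upd x t a) o = upd (ext x o) (lift ord_max t) a.
Proof.
apply/ffunP => k; rewrite updE; case: (unliftP ord_max k) => [l ->|->].
  by rewrite !ext_lift updE (inj_eq lift_inj).
by rewrite !ext_max (negPf (neq_lift _ _)).
Qed.

(** The isometry psi -> psi (x) |o>, as a matrix, so that identities for all psi can be checked on
    basis vectors. *)
Definition embed o : 'M[R[i]]_(#|cfg d N.+1|, #|cfg d N|) :=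
  \matrix_(k, l) (enum_val k == ext (enum_val l) o)%:R.

Lemma embed_ket o x : embed o *m ket R x = ket R (ext x o).
Proof.
rewrite -colE; apply/colP => k; rewrite !mxE enum_rankK andbT.
by rewrite -[in RHS](enum_valK k) (inj_eq enum_rank_inj).
Qed.

Lemma embed_apply_at o (U : 'M[R[i]]_d) t x :
  embed o *m apply_at U t x = apply_at U (lift ord_max t) (ext x o).
Proof.
rewrite /apply_at mulmx_sumr; apply: eq_bigr => a _.
by rewrite -scalemxAr embed_ket ext_upd ext_lift.
Qed.

Lemma tens_embed o (psi : qstate R d N) : o = 0 :> nat ->
  tens psi (ket0 R d) = embed o *m psi.
Proof.
move=> o0; apply/colP => k; rewrite !mxE; set y := enum_val k.
pose z : cfg d N := [ffun i => y (lift ord_max i)].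
have yE x : (y == ext x o) = (x == z) && (y ord_max == o).
  apply/eqP/andP => [yx|[/eqP-> /eqP yo]].
    rewrite yx ext_max eqxx; split=> //; apply/eqP/ffunP => i.
    by rewrite [RHS]ffunE yx ext_lift.
  apply/ffunP => i; case: (unliftP ord_max i) => [l ->|->].
    by rewrite ext_lift ffunE.
  by rewrite ext_max.
rewrite (bigD1 (enum_rank z)) //= big1 ?addr0 => [|l lz].
  by rewrite [embed _ _ _]mxE [ket0 _ _ _ _]mxE enum_rankK yE eqxx -val_eqE /= o0 mulrC.
rewrite [embed _ _ _]mxE yE; case: eqP => [lz'|]; last by rewrite mul0r.
by rewrite -lz' enum_valK eqxx in lz.
Qed.

End CleanAncilla.

(** * The count, and assembly of the circuit *)

Lemma NSU_bound (d n m : nat) : (2 <= d)%N -> (7 <= n)%N -> m.+2 = n.-1 ->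
  (8 * m + 8 + (8 + (8 * m + 8)))%N%:Z <= 2 * NSU d n.
Proof.
(* [m] is the number of controls beyond the first two, so the cost is 16n - 24. For d = 3 the claim
   is 48n >= 296, which holds from n = 7 on. *)
move=> hd hn mn; have -> : m = (n - 3)%N by lia.
rewrite /NSU; case: eqP => [_|d2]; first lia.
case: eqP => [_|d3]; first lia.
(* The slack is 64(d-4)(n-6) + 160n - 968, so this product absorbs the nonlinear term and the rest
   is linear. *)
have : 0 <= (d%:Z - 4) * (n%:Z - 6) by rewrite mulr_ge0 //; lia.
rewrite mulrBl !mulrBr; lia.
Qed.

Theorem mainTheorem6 (R : realType) (d n : nat) (hd : (2 <= d)%N)
    (hn : (7 <= n)%N) (U : 'M[R[i]]_d) (hU : U \is unitarymx) (theta : R)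
    (htheta : - pi < theta <= pi) (htheta0 : theta != 0)
    (hdet : \det U = expi theta) (hdet1 : \det U != 1)
    (t : 'I_n) (ht : t = n.-1 :> nat) :
  exists (k : nat) (W : qop R d n.+1),
    [/\ circuit k W,
        k%:Z <= 2 * NSU d n
      & forall psi : qstate R d n,
          W *m tens psi (ket0 R d) =
          tens (cgate [set i : 'I_n | (i < n.-1)%N] t U *m psi) (ket0 R d)].
Proof.
have d0 : (0 < d)%N by exact: ltnW.
pose o : 'I_d := Ordinal d0.
pose S := [set i : 'I_n | (i < n.-1)%N].
have SE : S = [set~ t].
  apply/setP => i; rewrite !inE -val_eqE /= ht ltn_neqAle -ltnS prednK ?ltn_ord ?andbT //.
  exact: leq_trans hn.
pose c := [seq lift ord_max i | i <- enum S].
have uc : uniq c by rewrite map_inj_uniq ?enum_uniq //; exact: lift_inj.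
have sc : size c = n.-1 by rewrite size_map -cardE SE cardsC1 card_ord.
have anc : ord_max \notin c.
  by apply/mapP => -[i _] /eqP; rewrite (negPf (neq_lift _ _)).
have tc : lift ord_max t \notin c.
  by rewrite mem_map ?mem_enum ?SE ?inE ?eqxx //; exact: lift_inj.
have call x : all (fun i => on (ext x o i)) c = [forall i in S, on (x i)].
  apply/allP/forall_inP => [xc i iS|xS _ /mapP[i iS ->]].
    by rewrite -(ext_lift x o) xc // map_f // mem_enum.
  by rewrite ext_lift xS // -mem_enum.
have n1 : (1 < size c)%N by rewrite sc ltn_predRL (leq_trans _ hn).
case: c uc sc anc tc call n1 => [|c0 [|c1 s]] // uc sc anc tc call _.
have [anc0 anc1 ancs] : [/\ ord_max != c0, ord_max != c1 & ord_max \notin s].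
  by move: anc; rewrite !inE !negb_or => /and3P[].
have ta : lift ord_max t != ord_max by rewrite eq_sym neq_lift.
have [t0 t1 ts] : [/\ lift ord_max t != c0, lift ord_max t != c1 &
    lift ord_max t \notin s].
  by move: tc; rewrite !inE !negb_or => /and3P[].
have c01 : c0 != c1 by move: uc; rewrite /= !inE negb_or => /andP[/andP[]].
pose f := ladder c0 c1 s \o (step c0 c1 ord_max
            \o fun x : cfg d n.+1 => upd x ord_max (ord_pred (x ord_max))).
have cf : computes R (8 * size s + 8) f.
  rewrite -[(_ + 8)%N]addn0 -addnA.
  apply: computes_comp; first exact: computes_ladder.
  apply: computes_comp; last exact: computes_pred.
  by apply: computes_step => //=; rewrite !inE negb_or c01 ![_ == ord_max]eq_sym anc0 anc1.
have [] := circuit_computes_conj (p := ord_max) (q := c1) (t := lift ord_max t)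
  d0 _ hU cf.
- by rewrite /= !inE negb_or anc1 ![_ == lift _ _]eq_sym t1 ta.
- by move=> x; rewrite /f /= ladder_other // step_other // updE (negPf ta).
- move=> x a; rewrite /f /= updE [ord_max == _]eq_sym (negPf ta) upd_comm //.
  by rewrite step_upd ?ladder_upd // !inE !negb_or t0 t1 ta.
move=> W cW WE; exists (8 * size s + 8 + (8 + (8 * size s + 8)))%N, W; split=> //.
  exact: NSU_bound hd hn sc.
move=> psi; rewrite !(tens_embed (o := o)) // !mulmxA; congr (_ *m psi).
suff WEx x : W *m (embed R n o *m ket R x) = embed R n o *m (cgate S t U *m ket R x).
  apply/matrixP => k l; have /colP/(_ k) := WEx (enum_val l).
  by rewrite !mulmxA -!colE !mxE enum_valK => ->.
rewrite embed_ket WE cgate_ket.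
suff -> : on (f (ext x o) ord_max) && on (f (ext x o) c1) =
    [forall i in S, on (x i)].
  by case: ifP => _; rewrite ?embed_ket ?embed_apply_at.
rewrite -call /f /=; set y := upd _ _ _.
have yE i : i != ord_max -> y i = ext x o i.
  by move=> im; rewrite updE (negPf im).
have ya : on (y ord_max).
  by rewrite updE eqxx ext_max /on /= add0n modn_small // ltn_predL.
have [y0 y1] : y c0 = ext x o c0 /\ y c1 = ext x o c1.
  by split; apply: yE; rewrite eq_sym.
rewrite ladder_other // on_step // y0 y1.
case: (boolP (on (ext x o c0))) => //= x0.
case: (boolP (on (ext x o c1))) => //= x1.
have -> : step c0 c1 ord_max y = y by rewrite /step y0 y1 x0 x1.
rewrite on_ladder ?y0 ?y1 //; apply: eq_in_all => i si.
by rewrite yE //; apply: contraNneq ancs => <-.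
Qed.
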